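(* Suppose $f \colon \mathbb{B}_n \to \mathbb{B}_N$ is a rational proper map of degree $d$ of maximal embedding dimension for degree $d$. Then there exists a linear fractional map $\tau$ on $\mathbb{C}^N$ such that one of the following three conclusions holds: (i) $\tau \circ f \colon \mathbb{B}_n \to \mathbb{B}_N$ is a polynomial proper map. (ii) $\tau \circ f \colon \mathbb{B}_n \to \mathbb{B}_{1,N-1}$ is a polynomial proper map. (iii) $\tau \circ f \colon \mathbb{B}_n \to \mathbb{H}_N$ is a polynomial proper map.
   Context: $\mathbb{B}_n \subset \mathbb{C}^n$ denotes the open unit ball. A rational proper map $f\colon \mathbb{B}_n \to \mathbb{B}_N$ is a proper holomorphic map of the form $\frac{p}{g}$ with $p \colon \mathbb{C}^n \to \mathbb{C}^N$ and $g\colon \mathbb{C}^n \to \mathbb{C}$ polynomial; when written in lowest terms (no common nonconstant polynomial factor of $g$ and the components of $p$) its degree is the maximum of the degrees of $p$ and $g$. The embedding dimension of $f$ is the smallest dimension $N'$ of a complex affine subspace of $\mathbb{C}^N$ containing the image of $f$. For degree $d$ maps from $\mathbb{B}_n$ the maximal embedding dimension is the number of nonconstant monomials of degree at most $d$ in $n$ variables, $\binom{n+d}{d}-1$; ''of maximal embedding dimension for degree $d$'' means the embedding dimension of $f$ equals this number. The other two models of the ball are $$\mathbb{B}_{1,N-1} = \{ z \in \mathbb{C}^N : |z_1|^2 - |z_2|^2 - \cdots - |z_N|^2 > 1 \},$$ $$\mathbb{H}_N = \{ z \in \mathbb{C}^N : \operatorname{Re} z_N > |z_1|^2 + \cdots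 + |z_{N-1}|^2 \}.$$ A linear fractional map on $\mathbb{C}^N$ is a (partially defined) map of $\mathbb{C}^N$ induced by an invertible projective linear transformation of $\mathbb{P}^N \supset \mathbb{C}^N$. *)

(* Defs.v *)
From HB Require Import structures.
From mathcomp Require Import all_boot all_order all_algebra.
From mathcomp Require Import all_classical all_reals all_analysis.
From mathcomp Require Import complex.
(* Without its notations, which clash with those of mathcomp-analysis. *)
From mathcomp Require Import -(notations) mpoly.

Set Implicit Arguments.
Unset Strict Implicit.
Unset Printing Implicit Defensive.

Import Order.TTheory GRing.Theory Num.Theory.
Import numFieldNormedType.Exports.

Local Open Scope classical_set_scope.
Local Open Scope ring_scope.
Local Open Scope complex_scope.

(* The type annotation is what gives [Cx R], and hence ['rV[Cx R]_n], the
   topology and norm that mathcomp-analysis attaches to every numFieldType. *)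
Definition Cx (R : realType) : numClosedFieldType := R[i].

(* The order of [Cx R] is partial: [a < b] means that [b - a] is a positive real.
   All quantities compared below are real. *)

Definition unit_ball (R : realType) (n : nat) : set 'rV[Cx R]_n :=
  [set z : 'rV_n | \sum_(i < n) `|z 0 i| ^+ 2 < 1].
Arguments unit_ball : clear implicits.

(* The coordinates z_1, ..., z_N are [z 0 i] for i = 0, ..., N - 1. *)
Definition hyperbolic_ball (R : realType) (N : nat) : set 'rV[Cx R]_N :=
  [set z : 'rV_N | 1 < \sum_(i < N | i == 0%N :> nat) `|z 0 i| ^+ 2
               - \sum_(i < N | i != 0%N :> nat) `|z 0 i| ^+ 2].
Arguments hyperbolic_ball : clear implicits.

Definition half_space (R : realType) (N : nat) : set 'rV[Cx R]_N :=
  [set z : 'rV_N | \sum_(i < N | i.+1 != N) `|z 0 i| ^+ 2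
           < \sum_(i < N | i.+1 == N) 'Re (z 0 i)].
Arguments half_space : clear implicits.

Section Maps.
Context {R : realType} {n N : nat}.
Implicit Types (U : set 'rV[Cx R]_n) (V : set 'rV[Cx R]_N).
Implicit Types (f : 'rV[Cx R]_n -> 'rV[Cx R]_N).

(* Functions are total; a map U -> V is represented by any total function whose
   restriction to U it is. For open U, no notion below depends on the values
   outside U. *)

(* Frechet differentiability over the field [Cx R] is complex
   differentiability. *)
Definition holomorphic_on U f : Prop := forall z, U z -> differentiable f z.

Definition proper_holomorphic_map U V f : Prop :=
  [/\ holomorphic_on U f,
      f @` U `<=` V
    & forall K, K `<=` V -> compact K -> compact (U `&` f @^-1` K)].

Definition poly_map (p : 'I_N -> mpoly n (Cx R)) (z : 'rV[Cx R]_n) :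
  'rV[Cx R]_N := \row_j meval (z 0) (p j).

(* f = p / g on U. The denominator is only required to be a nonzero polynomial;
   the formula is imposed off its zero set. *)
Definition rational_form U f
    (p : 'I_N -> mpoly n (Cx R)) (g : mpoly n (Cx R)) : Prop :=
  g != 0 /\
  forall z, U z -> meval (z 0) g != 0 ->
    f z = (meval (z 0) g)^-1 *: poly_map p z.

Definition lowest_terms
    (p : 'I_N -> mpoly n (Cx R)) (g : mpoly n (Cx R)) : Prop :=
  forall h : mpoly n (Cx R),
    (exists g', g = h * g') -> (forall j, exists q, p j = h * q) ->
    exists c : Cx R, h = mpolyC n c.

(* [msize] is the total degree plus one, and is 0 for the zero polynomial. *)
Definition max_degree
    (p : 'I_N -> mpoly n (Cx R)) (g : mpoly n (Cx R)) : nat :=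
  maxn (\max_(j < N) (msize (p j)).-1) (msize g).-1.

Definition rational_degree U f (d : nat) : Prop :=
  exists p g, [/\ rational_form U f p g, lowest_terms p g & max_degree p g = d].

Definition rational_proper_map U V f : Prop :=
  proper_holomorphic_map U V f /\ exists p g, rational_form U f p g.

Definition polynomial_proper_map U V f : Prop :=
  proper_holomorphic_map U V f /\
  exists p, forall z, U z -> f z = poly_map p z.

Definition image_in_affine_subspace U f (k : nat) : Prop :=
  exists (a : 'rV[Cx R]_N) (W : {vspace 'rV[Cx R]_N}),
    \dim W = k /\ f @` U `<=` [set a + w | w in [set` W]].

Definition embedding_dimension U f (k : nat) : Prop :=
  image_in_affine_subspace U f k /\
  forall k', image_in_affine_subspace U f k' -> (k <= k')%N.

End Maps.

Section LinearFractional.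
Context {R : realType} {N : nat}.
Implicit Types (M : 'M[Cx R]_(N + 1)) (z : 'rV[Cx R]_N).

(* C^N sits in P^N as the points [z_1 : ... : z_N : 1], and M acts on the
   homogeneous coordinates on the right. *)
Definition lf_homogeneous M z : 'rV[Cx R]_(N + 1) := row_mx z 1%:M *m M.

Definition lf_denominator M z : Cx R := rsubmx (lf_homogeneous M z) 0 0.

Definition lf_domain M : set 'rV[Cx R]_N := [set z | lf_denominator M z != 0].

(* Only meaningful on [lf_domain M]. *)
Definition lf_map M z : 'rV[Cx R]_N :=
  (lf_denominator M z)^-1 *: lsubmx (lf_homogeneous M z).

End LinearFractional.

(* Main.v *)
(* Write f = p / g with p and g of degree at most d. Maximality of the embedding
   dimension means that the components of p together with g span all polynomials
   of degree at most d; otherwise f would map into an affine subspace of smaller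
   dimension. In particular 1 = L(p, g) for a linear form L, and any projective
   transformation with last coordinate proportional to L makes f polynomial.
   The ball is the positive cone of the Lorentz form |w_{N+1}|^2 - sum |w_j|^2,
   and the three conclusions correspond to the sign of the dual form at L:
   positive gives the ball, negative the hyperbolic ball, zero the half space.
   The transformation is a reflection, moving L to a model linear form, followed
   by a change of two coordinates. *)
Require Import Defs.
From HB Require Import structures.
From mathcomp Require Import all_boot all_order all_algebra.
From mathcomp Require Import all_classical all_reals all_analysis.
From mathcomp Require Import complex.
From mathcomp Require Import -(notations) mpoly.
From mathcomp Require Import ring zify.

Set Implicit Arguments.
Unset Strict Implicit.
Unset Printing Implicit Defensive.

Import Order.TTheory GRing.Theory Num.Theory.
Import numFieldNormedType.Exports.

Local Open Scope classical_set_scope.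
Local Open Scope ring_scope.

(** * Indefinite Hermitian forms *)

Section HermitianForms.
Context {C : numClosedFieldType}.

Definition adjmx m k (A : 'M[C]_(m, k)) : 'M[C]_(k, m) := map_mx Num.conj A^T.

Lemma adjmxM m k l (A : 'M[C]_(m, k)) (B : 'M[C]_(k, l)) :
  adjmx (A *m B) = adjmx B *m adjmx A.
Proof. by rewrite /adjmx trmx_mul map_mxM. Qed.

Lemma adjmxK m k (A : 'M[C]_(m, k)) : adjmx (adjmx A) = A.
Proof. by apply/matrixP => i j; rewrite !mxE conjCK. Qed.

Lemma adjmxB m k (A B : 'M[C]_(m, k)) : adjmx (A - B) = adjmx A - adjmx B.
Proof. by apply/matrixP => i j; rewrite !mxE rmorphB. Qed.

Lemma adjmxZ m k a (A : 'M[C]_(m, k)) : adjmx (a *: A) = a^* *: adjmx A.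
Proof. by apply/matrixP => i j; rewrite !mxE rmorphM. Qed.

Lemma adjmx1 m : adjmx 1%:M = 1%:M :> 'M[C]_m.
Proof. by rewrite /adjmx trmx1 map_mx1. Qed.

Definition sform m (J : 'M[C]_m) (u v : 'cV[C]_m) : C :=
  (adjmx u *m J *m v) 0 0.

(** [R] acts on row vectors from the right and on columns, read as linear forms, from the left; the
    equation preserves the form [J] on rows. *)
Definition form_isometry m (J R : 'M[C]_m) : Prop :=
  R \in unitmx /\ R *m J *m adjmx R = J.

(** * Reflections and transitivity of isometries *)

Section Reflection.
Context {m : nat} (J : 'M[C]_m).
Hypotheses (JJ : J *m J = 1%:M) (adjJ : adjmx J = J).

Lemma sformE u v : adjmx u *m J *m v = (sform J u v)%:M.
Proof. by rewrite [LHS]mx11_scalar. Qed.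

Lemma sformBl u v w : sform J (u - v) w = sform J u w - sform J v w.
Proof. by rewrite /sform adjmxB !mulmxBl !mxE. Qed.

Lemma sformBr u v w : sform J w (u - v) = sform J w u - sform J w v.
Proof. by rewrite /sform mulmxBr !mxE. Qed.

Lemma sformZl a u v : sform J (a *: u) v = a^* * sform J u v.
Proof. by rewrite /sform adjmxZ -!scalemxAl mxE. Qed.

Lemma sformZr a u v : sform J u (a *: v) = a * sform J u v.
Proof. by rewrite /sform -!scalemxAr mxE. Qed.

Lemma sformC u v : sform J v u = (sform J u v)^*.
Proof.
have -> : (sform J u v)^* = adjmx (adjmx u *m J *m v) 0 0.
  by rewrite [RHS]mxE mxE.
by rewrite !adjmxM adjmxK adjJ mulmxA.
Qed.

Definition reflection (u : 'cV[C]_m) : 'M[C]_m :=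
  1%:M - (2 / sform J u u) *: (u *m adjmx u *m J).

(** [u u^* J] squares to [q] times itself, so for [a = 2 / q] the terms in [a] and [a ^ 2] cancel,
    both in the square of the reflection and in the isometry equation. *)
Lemma isometry_reflection u : sform J u u != 0 -> form_isometry J (reflection u).
Proof.
rewrite /reflection; set q := sform J u u => q0; set a := 2 / q.
have qR : q^* = q by rewrite /q -sformC.
have aR : a^* = a by rewrite /a rmorphM fmorphV/= qR rmorph_nat.
have aaq : a * (a * q) = a + a by rewrite /a; field.
have uJu : u *m adjmx u *m J *m u = q *: u.
  by rewrite -2!mulmxA [_ *m (J *m u)]mulmxA sformE mul_mx_scalar.
split.
  suff /mulmx1_unit[] : (1%:M - a *: (u *m adjmx u *m J)) *m
      (1%:M - a *: (u *m adjmx u *m J)) = 1%:M by [].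
  rewrite mulmxBl mul1mx mulmxBr mulmx1 -scalemxAl -scalemxAr.
  rewrite !mulmxA uJu -!scalemxAl !scalerA aaq scalerDl.
  by rewrite opprB addrK subrK.
rewrite adjmxB adjmx1 adjmxZ aR !adjmxM adjmxK adjJ.
rewrite mulmxBl mul1mx -scalemxAl -!mulmxA JJ mulmx1.
rewrite mulmxBr mulmx1 mulmxBl -!scalemxAr -scalemxAl !mulmxA JJ mul1mx.
rewrite uJu -!scalemxAl !scalerA -mulrA aaq scalerDl.
by rewrite opprB addrK subrK.
Qed.

(* The reflection in [e - x] exchanges [e] and [x]. *)
Lemma isometry_exchange e x :
  sform J e e = sform J x x -> sform J e x = sform J x e ->
  sform J (e - x) (e - x) != 0 -> exists2 R, form_isometry J R & R *m e = x.
Proof.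
move=> ee ex nz; exists (reflection (e - x)); first exact: isometry_reflection.
rewrite /reflection mulmxBl mul1mx -scalemxAl -!mulmxA [_ *m (J *m _)]mulmxA.
rewrite sformE mul_mx_scalar scalerA.
(* Equal norms and a symmetric mixed term give [<e - x, e - x> = 2 <e - x, e>]. *)
suff -> : 2 / sform J (e - x) (e - x) * sform J (e - x) e = 1.
  by rewrite scale1r subKr.
apply: (mulIf nz); rewrite mulrAC divfK// mul1r.
by rewrite !sformBr !sformBl -ee -ex; ring.
Qed.

(** Scaling gives [l] the norm of [e] and leaves the phase free; the phase is chosen so that
    [e - c l] is not null and the reflection in it exists. *)
Lemma isometry_onto_line e l (s : C) : s = 1 \/ s = -1 ->
  sform J e e = s -> 0 < s * sform J l l ->
  exists c R, [/\ c != 0, form_isometry J R & R *m e = c *: l].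
Proof.
move=> s1 ee ll0.
have ss : s * s = 1 by case: s1 => ->; ring.
have sR : s^* = s by rewrite -ee -sformC.
have s_neq0 : s != 0 by case: s1 => ->; rewrite ?oppr_eq0 oner_eq0.
set t := sform J e l; set r := sqrtC (s * sform J l l).
have r0 : 0 < r by rewrite sqrtC_gt0.
have r2 : r * r = s * sform J l l by rewrite -expr2 sqrtCK.
have rR : r^* = r by apply: conj_Creal; rewrite realE ltW.
(* A unit scalar turning [t] into its modulus; for [t = 0] any would do. *)
pose h := if t == 0 then 1 else t^* / `|t|.
have hh : h * h^* = 1.
  rewrite /h; case: eqP => [_|/eqP t0]; first by rewrite rmorph1 mulr1.
  rewrite rmorphM fmorphV/= conjCK (conj_Creal (normr_real t)).
  by rewrite mulrACA (mulrC _ t) -normCK -invfM -expr2 divff// expf_neq0 ?normr_eq0.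
have ht : h * t = `|t|.
  rewrite /h; case: eqP => [->|/eqP t0]; first by rewrite mulr0 normr0.
  by rewrite mulrAC (mulrC _ t) -normCK expr2 mulfK ?normr_eq0.
(* [r] normalises the length, [h] makes the product with [e] real, and the sign prevents
   cancellation: [e - c l] has norm [2 s (1 + |t| / r)]. *)
pose c := - s * h / r.
have h0 : h != 0 by apply: contra_eq_neq hh => ->; rewrite mul0r eq_sym oner_eq0.
have rn0 : r != 0 by rewrite gt_eqF.
have c0 : c != 0 by rewrite /c !mulf_neq0 ?oppr_eq0 ?invr_eq0.
have cc : c^* * c = (s * sform J l l)^-1.
  rewrite -r2 /c !rmorphM/= fmorphV rmorphN/= sR rR.
  transitivity ((s * s) * (h * h^*) / (r * r)); first by field.
  by rewrite ss hh; field.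
have ecl : sform J e (c *: l) = - s * (`|t| / r).
  by rewrite sformZr -/t -ht /c; field.
have lle : sform J (c *: l) (c *: l) = s.
  have l0 : sform J l l != 0.
    by apply: contraTneq ll0 => ->; rewrite mulr0 ltxx.
  rewrite sformZl sformZr mulrA cc invfM -mulrA mulVf// mulr1.
  by apply: (mulfI s_neq0); rewrite ss mulfV.
have tr0 : 0 <= `|t| / r by rewrite divr_ge0 ?normr_ge0 ?(ltW r0).
have cle : sform J (c *: l) e = - s * (`|t| / r).
  rewrite sformC ecl rmorphM rmorphN/= sR; congr (_ * _).
  by apply: conj_Creal; rewrite realE tr0.
have [R isoR Re] : exists2 R, form_isometry J R & R *m e = c *: l.
  apply: isometry_exchange; rewrite ?ee ?lle ?ecl ?cle//.
  rewrite !sformBr !sformBl ee lle ecl cle.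
  have -> : s - - s * (`|t| / r) - (- s * (`|t| / r) - s) =
            s * (2 * (1 + `|t| / r)) by ring.
  by rewrite mulf_neq0// mulf_neq0 ?pnatr_eq0// gt_eqF// ltr_wpDr.
by exists c, R.
Qed.

(** Scaling to [<e, c l> = 1] gives [e - c l] norm -2, so the reflection in it exists. *)
Lemma isometry_onto_null_line e l :
  sform J e e = 0 -> sform J l l = 0 -> sform J e l != 0 ->
  exists c R, [/\ c != 0, form_isometry J R & R *m e = c *: l].
Proof.
move=> ee ll el.
pose c := (sform J e l)^-1.
have ecl : sform J e (c *: l) = 1 by rewrite sformZr mulVf.
have cle : sform J (c *: l) e = 1 by rewrite sformC ecl rmorph1.
have cll : sform J (c *: l) (c *: l) = 0 by rewrite sformZl sformZr ll !mulr0.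
have [R isoR Re] : exists2 R, form_isometry J R & R *m e = c *: l.
  apply: isometry_exchange; rewrite ?ee ?cll ?ecl ?cle//.
  rewrite !sformBr !sformBl ee cll ecl cle.
  by rewrite sub0r subr0 -opprD oppr_eq0 -[1 + 1]/(2%:R) pnatr_eq0.
by exists c, R; rewrite invr_eq0.
Qed.

End Reflection.

(** * The Lorentz form and coordinate changes in a plane *)

Section Lorentz.
Context {N : nat}.
Notation last := (rshift N (0 : 'I_1)).

(** Its own inverse, so it gives both the form on rows and the dual form on columns. *)
Definition lorentz_mx : 'M[C]_(N + 1) := diag_mx (row_mx (const_mx (-1)) 1%:M).

Definition lorentz (w : 'rV[C]_(N + 1)) : C :=
  `|w 0 last| ^+ 2 - \sum_(j < N) `|w 0 (lshift 1 j)| ^+ 2.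

Lemma lorentz_mxK : lorentz_mx *m lorentz_mx = 1%:M.
Proof.
rewrite /lorentz_mx mulmx_diag -[RHS]diag_const_mx; congr (diag_mx _); apply/rowP => j.
rewrite !mxE; case: splitP => k _; rewrite !mxE ?mulrNN ?mulr1//.
by rewrite !ord1 eqxx mulr1.
Qed.

Lemma adj_lorentz_mx : adjmx lorentz_mx = lorentz_mx.
Proof.
rewrite /adjmx tr_diag_mx map_diag_mx; congr (diag_mx _); apply/rowP => j.
rewrite !mxE; case: splitP => k _; rewrite !mxE ?rmorphN ?rmorph1//.
by rewrite !ord1 eqxx rmorph1.
Qed.

Lemma sform_lorentz (u v : 'cV[C]_(N + 1)) :
  sform lorentz_mx u v = (u last 0)^* * v last 0
    - \sum_(j < N) (u (lshift 1 j) 0)^* * v (lshift 1 j) 0.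
Proof.
rewrite /sform mul_mx_diag mxE big_split_ord/= big_ord1 addrC.
rewrite !mxE (unsplitK (inr _)) !mxE mulr1; congr (_ + _).
rewrite -sumrN; apply: eq_bigr => j _.
by rewrite !mxE (unsplitK (inl _)) !mxE mulrN1 mulNr.
Qed.

Lemma lorentzE w : lorentz w = (w *m lorentz_mx *m adjmx w) 0 0.
Proof.
rewrite -[in RHS](adjmxK w) adjmxK.
have -> : (w *m lorentz_mx *m adjmx w) 0 0 =
          sform lorentz_mx (adjmx w) (adjmx w) by rewrite /sform adjmxK.
rewrite sform_lorentz /lorentz !mxE conjCK normCK; congr (_ - _).
by apply: eq_bigr => j _; rewrite !mxE conjCK normCK.
Qed.

Lemma lorentz_isometry R w :
  form_isometry lorentz_mx R -> lorentz (w *m R) = lorentz w.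
Proof.
move=> [_ RJR]; rewrite !lorentzE adjmxM -!mulmxA.
by do 2 rewrite [_ *m (_ *m adjmx w)]mulmxA; rewrite [R *m _]mulmxA RJR !mulmxA.
Qed.

Lemma lorentzZ a w : lorentz (a *: w) = `|a| ^+ 2 * lorentz w.
Proof.
rewrite /lorentz mulrBr mulr_sumr mxE normrM exprMn; congr (_ - _).
by apply: eq_bigr => j _; rewrite mxE normrM exprMn.
Qed.

Lemma lorentz_row_mx1 (z : 'rV[C]_N) :
  lorentz (row_mx z 1%:M) = 1 - \sum_(j < N) `|z 0 j| ^+ 2.
Proof.
rewrite /lorentz row_mxEr mxE eqxx normr1 expr1n; congr (_ - _).
by apply: eq_bigr => j _; rewrite row_mxEl.
Qed.

(* The matrix acting as [[a, b], [c, d]] on the coordinates [p] and [last]. *)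
Definition plane_mx (p : 'I_N) (a b c d : C) : 'M[C]_(N + 1) :=
  \matrix_(k, j)
    (if j == last then b * (k == lshift 1 p)%:R + d * (k == last)%:R
     else if j == lshift 1 p then a * (k == lshift 1 p)%:R + c * (k == last)%:R
     else (k == j)%:R).

Lemma mul_plane_mx m p a b c d (X : 'M[C]_(m, N + 1)) i j :
  (X *m plane_mx p a b c d) i j =
    (if j == last then X i (lshift 1 p) * b + X i last * d
     else if j == lshift 1 p then X i (lshift 1 p) * a + X i last * c
     else X i j).
Proof.
have S y k0 : \sum_k X i k * (y * (k == k0)%:R) = X i k0 * y.
  rewrite (bigD1 k0)//= eqxx mulr1 big1 ?addr0// => k /negPf ->.
  by rewrite !mulr0.
rewrite mxE; under eq_bigr do rewrite mxE.
case: ifP => _; last case: ifP => _.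
- by under eq_bigr do rewrite mulrDr; rewrite big_split/= !S.
- by under eq_bigr do rewrite mulrDr; rewrite big_split/= !S.
- by under eq_bigr do rewrite -[(_ == _)%:R]mul1r; rewrite S mulr1.
Qed.

Lemma plane_mxM p a b c d a' b' c' d' :
  a * a' + b * c' = 1 -> a * b' + b * d' = 0 ->
  c * a' + d * c' = 0 -> c * b' + d * d' = 1 ->
  plane_mx p a b c d *m plane_mx p a' b' c' d' = 1%:M.
Proof.
move=> e1 e2 e3 e4; apply/matrixP => i j.
rewrite -[plane_mx p a b c d]mul1mx !mul_plane_mx.
have pl : (lshift 1 p == last) = false by rewrite eq_lrshift.
rewrite eqxx pl eqxx; case: eqP => [->|_]; last case: eqP => [->|_//].
- set x := 1%:M i _; set y := 1%:M i _.
  transitivity (x * (a * b' + b * d') + y * (c * b' + d * d')); first by ring.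
  by rewrite e2 e4; ring.
- set x := 1%:M i _; set y := 1%:M i _.
  transitivity (x * (a * a' + b * c') + y * (c * a' + d * c')); first by ring.
  by rewrite e1 e3; ring.
Qed.

(** Read on [row_mx z 1], this column is the model linear form [b z_p + d]. *)
Lemma col_last_plane_mx p a b c d :
  col last (plane_mx p a b c d) =
    \col_k (b * (k == lshift 1 p)%:R + d * (k == last)%:R).
Proof. by apply/colP => k; rewrite !mxE eqxx. Qed.

Lemma sform_plane p b d v :
  sform lorentz_mx (\col_k (b * (k == lshift 1 p)%:R + d * (k == last)%:R)) v
  = d^* * v last 0 - b^* * v (lshift 1 p) 0.
Proof.
rewrite sform_lorentz !mxE eqxx eq_rlshift mulr0 add0r mulr1; congr (_ - _).
rewrite (bigD1 p)//= !mxE eqxx eq_lrshift mulr0 addr0 mulr1 big1 ?addr0//.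
move=> j /negPf jp; rewrite !mxE eq_lrshift (inj_eq (@lshift_inj _ _)) jp.
by rewrite !mulr0 addr0 rmorph0 mul0r.
Qed.

Lemma lorentz_plane p a b c d (z : 'rV[C]_N) :
  lorentz (row_mx z 1%:M *m plane_mx p a b c d) =
    `|z 0 p * b + d| ^+ 2 - `|z 0 p * a + c| ^+ 2
    - \sum_(j < N | j != p) `|z 0 j| ^+ 2.
Proof.
rewrite /lorentz mul_plane_mx eqxx row_mxEl row_mxEr mxE eqxx mul1r -addrA.
congr (_ + _); rewrite -opprD (bigD1 p)//=; congr (- (_ + _)).
  by rewrite mul_plane_mx eq_lrshift eqxx row_mxEl row_mxEr mxE eqxx mul1r.
apply: eq_bigr => j /negPf jp.
by rewrite mul_plane_mx eq_lrshift (inj_eq (@lshift_inj _ _)) jp row_mxEl.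
Qed.

(* [M] brings the linear form [l] to the last coordinate and turns the Lorentz
   form into its pull-back by [E]. *)
Definition normalizes (l : 'cV[C]_(N + 1)) (E M : 'M[C]_(N + 1)) : Prop :=
  [/\ M \in unitmx, exists2 c : C, c != 0 & col last M = c *: l
    & forall v, lorentz (v *m invmx M) = lorentz (v *m E)].

(** The witness is [M = R E']: the isometry [R] moves the model form onto the line of [l], and
    [M^-1 R = E] identifies the pull-back. *)
Lemma normalizes_ex l E E' : E *m E' = 1%:M ->
  (exists c R, [/\ c != 0, form_isometry lorentz_mx R & R *m col last E' = c *: l])
  -> exists M, normalizes l E M.
Proof.
move=> EE' [c [R [c0 isoR Re]]]; have [uE uE'] := mulmx1_unit EE'.
have [uR _] := isoR; exists (R *m E'); split.
- by rewrite unitmx_mul uR.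
- by exists c; rewrite // -Re !colE mulmxA.
- move=> v; have uM : R *m E' \in unitmx by rewrite unitmx_mul uR.
  rewrite -(lorentz_isometry (v *m _) isoR) -mulmxA; congr (lorentz (_ *m _)).
  have {2}-> : R = R *m E' *m E by rewrite -mulmxA (mulmx1C EE') mulmx1.
  by rewrite mulKmx.
Qed.

(** Exchange of [z_p] with the homogenising coordinate, relating the ball to its hyperbolic
    model. *)
Lemma plane_swap_mxM p : plane_mx p 0 1 1 0 *m plane_mx p 0 1 1 0 = 1%:M.
Proof. by apply: plane_mxM; ring. Qed.

(** On [z_p] this is the Cayley transform [s (1 - z_p) / (1 + z_p)], relating the half space to the
    ball; the sign [s] stays free to avoid an orthogonality later. *)
Lemma plane_cayley_mxM p (s : C) : s * s = 1 ->
  plane_mx p (- s / 2) (1 / 2) (s / 2) (1 / 2) *m plane_mx p (- s) s 1 1 = 1%:M.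
Proof.
move=> ss; apply: plane_mxM; try by field.
- transitivity (s * s / 2 + 1 / 2); first by field.
  by rewrite ss; field.
- transitivity (- (s * s) / 2 + 1 / 2); first by field.
  by rewrite ss; field.
- transitivity (- (s * s) / 2 + 1 / 2); first by field.
  by rewrite ss; field.
- transitivity (s * s / 2 + 1 / 2); first by field.
  by rewrite ss; field.
Qed.

End Lorentz.

End HermitianForms.

(** * Polynomials *)

Lemma mul_colE (S : pzSemiRingType) m n p (A : 'M[S]_(m, n)) (B : 'M[S]_(n, p)) i k :
  (A *m col k B) i 0 = (A *m B) i k.
Proof. by rewrite !mxE; apply: eq_bigr => j _; rewrite mxE. Qed.

(** Uniqueness of digits in base [B]: reduction modulo [B] gives the lowest digit, and induction
    handles the quotient. *)
Lemma base_expansion_inj (B n : nat) (a b : 'I_n -> nat) :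
  (forall i, a i < B)%N -> (forall i, b i < B)%N ->
  (\sum_i a i * B ^ i = \sum_i b i * B ^ i)%N -> a =1 b.
Proof.
elim: n a b => [|n IHn] a b aB bB; first by move=> _ [].
have shift (c : 'I_n.+1 -> nat) : (\sum_i c i * B ^ i =
    (\sum_(i < n) c (lift ord0 i) * B ^ i) * B + c ord0)%N.
  rewrite big_ord_recl expn0 muln1 addnC big_distrl/=; congr (_ + _)%N.
  by apply: eq_bigr => i _; rewrite /bump/= add1n expnSr mulnA.
rewrite !shift => eq_ab.
have B0 : (0 < B)%N by apply: leq_ltn_trans (aB ord0).
have eq0 : a ord0 = b ord0.
  by have := congr1 (modn^~ B) eq_ab; rewrite !modnMDl !modn_small.
move: eq_ab; rewrite eq0 => /addIn /eqP; rewrite eqn_pmul2r// => /eqP eqS i.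
have eq1 := IHn _ _ (fun i => aB (lift ord0 i)) (fun i => bB (lift ord0 i)) eqS.
by case: (unliftP ord0 i) => [j ->|->].
Qed.

(** * Points where a polynomial does not vanish *)

Section Roots.
Context {K : numFieldType} {n : nat}.
Implicit Types (g : mpoly n K).

(** Restriction of [g] to a polynomial curve. The formula for [r] is exported so that coefficients
    can be read off it. *)
Lemma meval_horner g (h : 'I_n -> {poly K}) : exists2 r : {poly K},
  r = \sum_(m <- msupp g) mcoeff m g *: \prod_i h i ^+ m i &
  forall t, r.[t] = meval (fun i => (h i).[t]) g.
Proof.
eexists; first by [].
move=> t; rewrite mevalE horner_sum; apply: eq_bigr => m _.
rewrite hornerZ horner_prod; congr (_ * _).
by apply: eq_bigr => i _; rewrite horner_exp.
Qed.

Lemma poly_nonroot_small (p : {poly K}) (e : K) :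
  p != 0 -> 0 < e -> exists t, [/\ 0 < t, t < e & p.[t] != 0].
Proof.
(* These [size p] distinct points outnumber the roots; denominators start at 2 to stay strictly
   below [e]. *)
move=> p0 e0; pose s := [seq e / k.+2%:R | k <- iota 0 (size p)].
have us : uniq s.
  rewrite map_inj_uniq ?iota_uniq// => i j /(mulfI (lt0r_neq0 e0)) /invr_inj.
  by move=> /eqP; rewrite eqr_nat => /eqP[].
have : ~~ all (root p) s.
  apply/negP => /(max_poly_roots p0)/(_ us).
  by rewrite size_map size_iota ltnn.
move=> /allPn[_ /mapP[k _ ->] pk]; exists (e / k.+2%:R); split => //.
  by rewrite divr_gt0// ltr0n.
by rewrite ltr_pdivrMr ?ltr0n// ltr_pMr// ltr1n.
Qed.

(* Kronecker's substitution [x_i = t ^ (B ^ i)], with [B] larger than all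
   exponents, sends distinct monomials to distinct powers of [t]. *)
Lemma mpoly_nonroot g : g != 0 -> exists v, meval v g != 0.
Proof.
move=> g0; pose B := msize g.
have [r rE rt] := meval_horner g (fun i => 'X ^+ (B ^ i)).
suff r0 : r != 0.
  have [t [_ _]] := poly_nonroot_small r0 ltr01.
  by rewrite rt; exists (fun i => ('X^(B ^ i)).[t]).
have code m : \prod_(i < n) ('X ^+ (B ^ i)) ^+ m i =
    'X^(\sum_(i < n) m i * B ^ i)%N :> {poly K}.
  by rewrite expr_sum; apply: eq_bigr => i _; rewrite -exprM mulnC.
have ltB m i : m \in msupp g -> (m i < B)%N.
  move=> /msize_mdeg_lt; apply: leq_ltn_trans.
  by rewrite mdegE (bigD1 i)//= leq_addr.
have m0 := mlead_supp g0; set m0' := mlead g in m0.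
suff : r`_(\sum_(i < n) m0' i * B ^ i)%N = mcoeff m0' g.
  move=> rm; apply: contraTneq m0 => r0.
  by rewrite mcoeff_msupp -rm r0 coef0 eqxx.
rewrite rE coef_sum (bigD1_seq m0')//= ?msupp_uniq// code coefZ coefXn eqxx.
rewrite mulr1 big_seq_cond big1 ?addr0// => m /andP[ms mm0].
rewrite code coefZ coefXn; case: eqP => [eqs|]; last by rewrite mulr0.
case/eqP: mm0; apply/mnmP/base_expansion_inj; last exact/esym/eqs.
  by move=> i; apply: ltB.
by move=> i; apply: ltB.
Qed.

(** On the line from [z] to a nonroot [v], the restriction of [g] is nonzero at [t = 1], hence has
    nonroots at arbitrarily small [t]. *)
Lemma nbhs_mpoly_nonroot g (z : 'rV[K]_n) (W : set 'rV[K]_n) :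
  g != 0 -> nbhs z W -> exists2 z', W z' & meval (z' 0) g != 0.
Proof.
move=> /mpoly_nonroot[v gv] zW.
have [r _ rt] := meval_horner g (fun i => (z 0 i)%:P + (v i - z 0 i) *: 'X).
have rE t : r.[t] = meval (fun i => z 0 i + t * (v i - z 0 i)) g.
  rewrite rt; apply: meval_eq => i.
  by rewrite hornerD hornerC hornerZ hornerX (mulrC t).
have r0 : r != 0.
  apply: contraNneq gv => r0; have := rE 1; rewrite r0 horner0 => ->.
  by apply/eqP/meval_eq => i; rewrite mul1r addrC subrK.
pose w : 'rV[K]_n := \row_i (v i - z 0 i).
have cw : continuous (fun t : K => z + t *: w).
  by move=> t; apply: (@cvgD _ _ _ (nbhs t) _); [exact: cvg_cst|exact: cvgZr_tmp].
have : nbhs (0 : K) [set t | W (z + t *: w)] by apply: cw; rewrite scale0r addr0.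
move=> /nbhs_ballP[e /= e0 eW].
have [t [t0 te rt0]] := poly_nonroot_small r0 e0.
exists (z + t *: w).
  by apply: eW; rewrite /ball/= sub0r normrN gtr0_norm.
move: rt0; rewrite rE; congr (_ != _); apply: meval_eq => i.
by rewrite !mxE.
Qed.

End Roots.

(** * Coefficient matrices and dimension counts *)

Section Dimension.
Context {K : fieldType}.

(** Exponent vectors inject into the tuples of sum at most [d], which the binomial counts. The index
    is [d.+1] because the degree bound of [bmultinom] is strict. *)
Lemma card_bmultinom n d : (#|{: bmultinom n d.+1}| <= 'C(n + d, d))%N.
Proof.
have -> : 'C(n + d, d) = 'C(n + d, n) by rewrite -[RHS]bin_sub ?leq_addr// addKn.
rewrite -card_partial_ord_partitions.
pose h (m : bmultinom n d.+1) : n.-tuple 'I_d.+1 := [tuple inord (m i) | i < n].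
have le_md (m : bmultinom n d.+1) i : (m i <= d)%N.
  have := bmdeg m; rewrite ltnS; apply: leq_trans.
  by rewrite mdegE (bigD1 i)//= leq_addr.
have hi m i : tnth (h m) i = m i :> nat.
  by rewrite tnth_mktuple inordK// ltnS.
rewrite -(card_imset _ (_ : injective h)); last first.
  move=> m1 m2 eqm; apply/val_inj/mnmP => i.
  by rewrite -!hi eqm.
apply/subset_leq_card/fintype.subsetP => _ /imsetP[m _ ->].
rewrite inE big_tuple; under eq_bigr do rewrite hi.
by rewrite -mdegE -ltnS bmdeg.
Qed.

Section Coefficients.
Context {n k : nat} (d : nat) (q : 'I_k -> mpoly n K).

(** For [q j] of degree at most [d], the right kernel is the space of linear relations between
    them. *)
Definition coef_mx : 'M[K]_(#|{: bmultinom n d.+1}|, k) :=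
  \matrix_(i, j) mcoeff (enum_val i : bmultinom n d.+1) (q j).

Hypothesis qd : forall j, (msize (q j) <= d.+1)%N.

Lemma coef_mx_comb (c : 'cV[K]_k) (p : mpoly n K) : (msize p <= d.+1)%N ->
  (forall i, (coef_mx *m c) i 0 = mcoeff (enum_val i : bmultinom n d.+1) p) ->
  \sum_j c j 0 *: q j = p.
Proof.
move=> pd cp; apply/mpolyP => m; rewrite raddf_sum/=.
have [md|md] := ltnP (mdeg m) d.+1.
  have := cp (enum_rank (BMultinom md)); rewrite enum_rankK/= => <-.
  rewrite mxE; apply: eq_bigr => j _.
  by rewrite mcoeffZ mxE enum_rankK mulrC.
have out (r : mpoly n K) : (msize r <= d.+1)%N -> mcoeff m r = 0.
  move=> rd; apply/memN_msupp_eq0; apply: contraL md => /msize_mdeg_lt.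
  by rewrite -ltnNge => /leq_trans; apply.
by rewrite out// big1// => j _; rewrite mcoeffZ out ?mulr0.
Qed.

(** Independent rows give a right inverse [D], so every coefficient vector is attained; the column
    of [D] at the constant monomial produces 1. *)
Lemma row_free_coef_mx : row_free coef_mx ->
  exists c : 'cV[K]_k, \sum_j c j 0 *: q j = 1.
Proof.
move=> /row_freeP[D cD].
have lt0 : (mdeg (@mnm0 n) < d.+1)%N by rewrite mdeg0.
pose i0 := enum_rank (BMultinom lt0); exists (col i0 D).
apply: coef_mx_comb => [|i]; first by rewrite msize1.
rewrite colE mulmxA cD mul1mx mxE eqxx andbT mcoeff1.
by rewrite -(can_eq enum_valK) enum_rankK bmeqP.
Qed.

(** The row space is the annihilator of the right kernel, whose vectors are relations between the
    polynomials. *)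
Lemma sub_coef_mx (u : 'rV[K]_k) :
  (forall c : 'cV[K]_k, \sum_j c j 0 *: q j = 0 -> u *m c = 0) ->
  (u <= coef_mx)%MS.
Proof.
move=> uq; rewrite submxE; apply/eqP/matrixP => i j.
rewrite -mul_colE (ord1 i) uq ?mxE//.
apply: coef_mx_comb => [|k0]; first by rewrite msize0.
by rewrite colE mulmxA mulmx_coker mul0mx mxE mcoeff0.
Qed.

End Coefficients.

(** Differences of vectors [(s, 1)] of [V] lie in the hyperplane with last coordinate 0. Since
    [(s1, 1)] is off it, intersecting costs a dimension. *)
Lemma affine_section_dim m N (V : 'M[K]_(m, N + 1)) (S : set 'rV[K]_N) s1 :
  S s1 -> (forall s, S s -> (row_mx s 1%:M <= V)%MS) ->
  exists2 W : {vspace 'rV[K]_N}, (\dim W < \rank V)%N &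
    forall s, S s -> s - s1 \in W.
Proof.
move=> S1 SV; pose e : 'M[K]_(N + 1, 1) := col_mx 0 1%:M.
have row_e (s : 'rV[K]_N) a : row_mx s a *m e = a.
  by rewrite mul_row_col mulmx0 add0r mulmx1.
pose W0 := (V :&: kermx e)%MS *m (col_mx 1%:M 0 : 'M[K]_(N + 1, N)).
have rW0 : (\rank W0 < \rank V)%N.
  rewrite -(mxrank_mul_ker V e); apply: (leq_ltn_trans (mxrankM_maxl _ _)).
  rewrite -[X in (X < _)%N]add0n ltn_add2r.
  have /mxrankS : (row_mx s1 1%:M *m e <= V *m e)%MS by rewrite submxMr// SV.
  by rewrite row_e mxrank1.
(* The row space of [W0] becomes a [vspace] as the image of coordinates in a row basis. *)
pose f : 'Hom('rV[K]_(\rank W0), 'rV[K]_N) := linfun (mulmxr (row_base W0)).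
exists (limg f).
  apply: leq_ltn_trans rW0.
  have dimr r : \dim {:'rV[K]_r} = r by rewrite dimvf dim_matrix mul1r.
  by rewrite -[X in (_ <= X)%N]dimr -(limg_ker_dim f) leq_addl.
move=> s Ss; have : (s - s1 <= W0)%MS.
  have -> : s - s1 = row_mx (s - s1) 0 *m (col_mx 1%:M 0 : 'M[K]_(N + 1, N)).
    by rewrite mul_row_col mulmx1 mul0mx addr0.
  apply: submxMr; rewrite sub_capmx; apply/andP; split; last first.
    by apply/sub_kermxP; rewrite row_e.
  have -> : row_mx (s - s1) 0 = row_mx s 1%:M - row_mx s1 1%:M :> 'rV[K]_(N + 1).
    by rewrite opp_row_mx add_row_mx subrr.
  by rewrite addmx_sub ?eqmx_opp ?SV.
rewrite -(eq_row_base W0) => /submxP[u ->].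
by apply/memv_imgP; exists u; rewrite ?memvf// lfunE.
Qed.

End Dimension.

(** * Differentiability and projective transformations *)

Lemma cvg_bigsum (K : numFieldType) (T : Type) (F : set_system T) {FF : Filter F}
    (I : Type) (s : seq I) (f : I -> T -> K) (a : I -> K) :
  (forall i, f i x @[x --> F] --> a i) ->
  \sum_(i <- s) f i x @[x --> F] --> \sum_(i <- s) a i.
Proof.
move=> fa; elim: s => [|i s IHs].
  by under eq_fun do rewrite big_nil; rewrite big_nil; exact: cvg_cst.
by under eq_fun do rewrite big_cons; rewrite big_cons; exact: cvgD.
Qed.

Section Differentiability.
Context {K : numFieldType}.

Lemma differentiable_bigsum (V : normedModType K) (I : Type) (s : seq I)
    (F : I -> V -> K) z : (forall i, differentiable (F i) z) ->
  differentiable (fun x => \sum_(i <- s) F i x) z.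
Proof.
move=> dF; elim: s => [|i s IHs].
  by under eq_fun do rewrite big_nil; exact: differentiable_cst.
under eq_fun do rewrite big_cons.
exact: (@differentiableD _ _ _ (F i)).
Qed.

Lemma differentiable_bigprod (V : normedModType K) (I : Type) (s : seq I)
    (F : I -> V -> K) z : (forall i, differentiable (F i) z) ->
  differentiable (fun x => \prod_(i <- s) F i x) z.
Proof.
move=> dF; elim: s => [|i s IHs].
  by under eq_fun do rewrite big_nil; exact: differentiable_cst.
under eq_fun do rewrite big_cons.
exact: (@differentiableM _ _ (F i)).
Qed.

Lemma differentiable_meval n (p : mpoly n K) z :
  differentiable (fun x : 'rV[K]_n => meval (x 0) p : K) z.
Proof.
under eq_fun do rewrite mevalE.
apply: differentiable_bigsum => m.
apply: (@differentiableM _ _ (fun=> mcoeff m p)); first exact: differentiable_cst.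
apply: differentiable_bigprod => i.
have -> : (fun x : 'rV[K]_n => x 0 i ^+ m i) = (fun x => \prod_(j < m i) x 0 i).
  by apply/funext => x; rewrite prodr_const card_ord.
by apply: differentiable_bigprod => _; exact: differentiable_coord.
Qed.

Lemma differentiable_row (V : normedModType K) N (f : V -> 'rV[K]_N) z :
  (forall j, differentiable (fun x => f x 0 j : K) z) -> differentiable f z.
Proof.
move=> df.
have -> : f = \sum_(j < N) (fun x => f x 0 j *: delta_mx 0 j).
  by apply/funext => x; rewrite fct_sumE -row_sum_delta.
by apply: differentiable_sum => j; apply: differentiableZl.
Qed.

End Differentiability.

Section ProjectiveTransformations.
Context {R : realType} {N : nat}.
Implicit Types (M : 'M[Cx R]_(N + 1)) (z : 'rV[Cx R]_N).
Notation last := (rshift N (0 : 'I_1)).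

Lemma lf_denominatorE M z : lf_denominator M z = lf_homogeneous M z 0 last.
Proof. by rewrite /lf_denominator mxE. Qed.

Lemma differentiable_affine_form (c : 'cV[Cx R]_(N + 1)) z :
  differentiable (fun x => (row_mx x 1%:M *m c) 0 0 : Cx R) z.
Proof.
have -> : (fun x => (row_mx x 1%:M *m c) 0 0 : Cx R) =
    (fun x : 'rV[Cx R]_N => \sum_(j < N) x 0 j * c (lshift 1 j) 0) + cst (c last 0).
  apply/funext => x; rewrite mxE big_split_ord/= big_ord1.
  rewrite row_mxEr mxE eqxx mul1r; congr (_ + _).
  by apply: eq_bigr => j _; rewrite row_mxEl.
apply: differentiableD; last exact: differentiable_cst.
apply: differentiable_bigsum => j.
apply: (@differentiableM _ _ (fun x : 'rV[Cx R]_N => x 0 j)).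
  exact: differentiable_coord.
exact: differentiable_cst.
Qed.

Lemma differentiable_lf_homogeneous M k z :
  differentiable (fun x => lf_homogeneous M x 0 k : Cx R) z.
Proof.
have -> : (fun x => lf_homogeneous M x 0 k : Cx R) =
    (fun x => (row_mx x 1%:M *m col k M) 0 0).
  by apply/funext => x; rewrite mul_colE.
exact: differentiable_affine_form.
Qed.

Lemma differentiable_lf_map M z :
  lf_domain M z -> differentiable (lf_map M : 'rV[Cx R]_N -> 'rV[Cx R]_N) z.
Proof.
rewrite /lf_domain/= lf_denominatorE => Mz; apply: differentiable_row => j.
have -> : (fun x => lf_map M x 0 j) =
    (fun x => (lf_homogeneous M x 0 last)^-1) *
    (fun x => lf_homogeneous M x 0 (lshift 1 j)).
  by apply/funext => x; rewrite /lf_map lf_denominatorE mxE; congr (_ * _); rewrite mxE.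
apply: differentiableM; last exact: differentiable_lf_homogeneous.
exact: (differentiableV (differentiable_lf_homogeneous M last z)).
Qed.

Lemma row_mx_lf_map M z : lf_domain M z ->
  row_mx (lf_map M z) 1%:M = (lf_denominator M z)^-1 *: lf_homogeneous M z.
Proof.
move=> Mz; rewrite -[lf_homogeneous M z in RHS]hsubmxK scale_row_mx.
congr row_mx; rewrite [X in _ *: X]mx11_scalar -/(lf_denominator M z).
by rewrite scale_scalar_mx mulVf.
Qed.

Lemma lf_homogeneousV M z : M \in unitmx -> lf_domain M z ->
  lf_homogeneous (invmx M) (lf_map M z) =
    (lf_denominator M z)^-1 *: row_mx z 1%:M.
Proof.
move=> uM Mz; rewrite {1}/lf_homogeneous row_mx_lf_map// -scalemxAl.
by rewrite mulmxK.
Qed.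

Lemma lf_mapK M z : M \in unitmx -> lf_domain M z ->
  lf_map (invmx M) (lf_map M z) = z.
Proof.
move=> uM Mz; rewrite /lf_map [lf_denominator (invmx M) _]lf_denominatorE.
rewrite -/(lf_map M z) lf_homogeneousV// mxE row_mxEr mxE eqxx mulr1 invrK.
by rewrite scale_row_mx row_mxKl scalerA mulfV// scale1r.
Qed.

Lemma unit_ball_lorentz z : unit_ball R N z <-> 0 < lorentz (row_mx z 1%:M).
Proof. by rewrite lorentz_row_mx1 subr_gt0. Qed.

(** A positive vector is never at infinity, so the inverse transformation is defined on the whole
    target. *)
Lemma lorentz_gt0_last (w : 'rV[Cx R]_(N + 1)) : 0 < lorentz w -> w 0 last != 0.
Proof.
apply: contraTneq => w0; rewrite /lorentz w0 normr0 expr0n/= sub0r oppr_gt0.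
by rewrite le_gtF// sumr_ge0// => j _; rewrite exprn_ge0.
Qed.

End ProjectiveTransformations.

(** Positivity of the Lorentz form matches [T] with the ball. The inverse transformation carries a
    compact subset of [T] to a compact subset of the ball, where properness of [f] applies. *)
Lemma proper_holomorphic_lf_map (R : realType) n N (f : 'rV[Cx R]_n -> 'rV[Cx R]_N)
    (M : 'M[Cx R]_(N + 1)) (U : set 'rV[Cx R]_n) (T : set 'rV[Cx R]_N) :
  M \in unitmx -> f @` U `<=` lf_domain M ->
  (forall z, T z <-> 0 < lorentz (row_mx z 1%:M *m invmx M)) ->
  proper_holomorphic_map U (unit_ball R N) f ->
  proper_holomorphic_map U T (lf_map M \o f).
Proof.
move=> uM fM TE [holf fU properf].
have fM' z : U z -> lf_domain M (f z) by move=> Uz; apply: fM; exists z.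
have TM z : T z -> lf_domain (invmx M) z.
  by move=> /TE; rewrite /lf_domain/= lf_denominatorE; exact: lorentz_gt0_last.
have norm_gt0 (a : Cx R) : a != 0 -> 0 < `|a| ^+ 2.
  by move=> a0; rewrite exprn_gt0// normr_gt0.
split.
- move=> z Uz; apply: differentiable_comp; first exact: holf.
  exact/differentiable_lf_map/fM'.
- move=> _ [z Uz <-]; apply/TE; have Mfz := fM' _ Uz.
  rewrite [X in lorentz X](lf_homogeneousV uM Mfz) lorentzZ mulr_gt0//.
    by rewrite norm_gt0// invr_eq0.
  by apply/unit_ball_lorentz/fU; exists z.
- move=> K KT cK.
  have sK : lf_map (invmx M) @` K `<=` unit_ball R N.
    move=> _ [z Kz <-]; have Tz := KT _ Kz.
    apply/unit_ball_lorentz; rewrite row_mx_lf_map; last exact: TM.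
    rewrite lorentzZ mulr_gt0//; last exact/TE.
    by rewrite norm_gt0// invr_eq0; exact: TM.
  have /(properf _ sK) : compact (lf_map (invmx M) @` K).
    apply: continuous_compact => //; apply: continuous_in_subspaceT => z.
    rewrite inE => Kz; apply: differentiable_continuous.
    exact/differentiable_lf_map/TM/KT.
  congr compact; apply/seteqP; split => z [Uz]/=.
    move=> [w Kw wz]; split => //=; rewrite -wz.
    by rewrite -{1}[M]invmxK lf_mapK ?unitmx_inv//; exact/TM/KT.
  move=> Kz; split => //; exists (lf_map M (f z)) => //.
  by rewrite lf_mapK//; exact: fM'.
Qed.

Lemma nbhs_unit_ball (R : realType) n (z : 'rV[Cx R]_n) :
  unit_ball R n z -> nbhs z (unit_ball R n).
Proof.
move=> zU; pose F (x : 'rV[Cx R]_n) : Cx R := \sum_(i < n) `|x 0 i| ^+ 2.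
(* The order compares only real differences, so realness is what turns a distance bound into an
   inequality. *)
have FR x : F x \is Num.real.
  by apply: ger0_real; apply: sumr_ge0 => i _; rewrite exprn_ge0.
have cF : F x @[x --> z] --> F z.
  apply: (@cvg_bigsum _ _ (nbhs z) _) => i; rewrite expr2.
  under eq_fun do rewrite expr2.
  have ci : `|x 0 i| @[x --> z] --> `|z 0 i|.
    by apply: (@cvg_norm _ _ _ (nbhs z)); exact: coord_continuous.
  exact: (@cvgM _ _ (nbhs z)).
have e0 : 0 < 1 - F z by rewrite subr_gt0.
have := @cvgr_distC_lt _ (Cx R) _ (nbhs z) (nbhs_filter z) _ _ cF _ e0.
apply: (@filterS _ (nbhs z) _) => x Fx.
suff : F x < 1 by [].
have : F x - F z < 1 - F z.
  by apply: le_lt_trans Fx; rewrite real_ler_norm// rpredB.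
by rewrite ltrD2r.
Qed.

(** * Normal forms of a linear form under Lorentz isometries *)

Lemma exists_normal_form (R : realType) N (l : 'cV[Cx R]_(N + 1)) : l != 0 ->
  exists E M : 'M[Cx R]_(N + 1), normalizes l E M /\
    exists2 T : set 'rV[Cx R]_N,
      forall z, T z <-> 0 < lorentz (row_mx z 1%:M *m E)
    & [\/ T = unit_ball R N, T = hyperbolic_ball R N | T = half_space R N].
Proof.
move=> l0; set last := rshift N (0 : 'I_1).
pose J : 'M[Cx R]_(N + 1) := lorentz_mx; pose s := sform J l l.
have JJ : J *m J = 1%:M := lorentz_mxK.
have adjJ : adjmx J = J := adj_lorentz_mx.
have sE : s = `|l last 0| ^+ 2 - \sum_(j < N) `|l (lshift 1 j) 0| ^+ 2.
  rewrite /s sform_lorentz normCK mulrC; congr (_ - _).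
  by apply: eq_bigr => j _; rewrite normCK mulrC.
have sR : s \is Num.real.
  by apply/CrealP; rewrite /s -sformC.
have [s_gt0|s_le0] := real_ltP (real0 _) sR.
  have [|M nM] := @normalizes_ex _ _ l _ _ (mulmx1 1%:M).
    apply: (@isometry_onto_line _ _ _ JJ adjJ _ _ 1); first by left.
      rewrite sform_lorentz !mxE eqxx rmorph1 mulr1 big1 ?subr0// => j _.
      by rewrite !mxE eq_lrshift mulr0.
    by rewrite mul1r.
  exists 1%:M, M; split=> //; exists (unit_ball R N); last by constructor 1.
  by move=> z; rewrite mulmx1; exact: unit_ball_lorentz.
(* In dimension 0 the dual form is nonnegative, so [s <= 0] would force [l = 0]; hence there is a
   coordinate to pair with the last one. *)
case: N => [|N] in l l0 @last @J @s JJ adjJ sE sR s_le0 *.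
  have l00 : l last 0 = 0.
    apply/eqP; rewrite -normr_eq0 -sqrf_eq0 eq_le exprn_ge0// andbT.
    by move: s_le0; rewrite sE big_ord0 subr0.
  case/eqP: l0; apply/colP => i; rewrite mxE -l00; congr (l _ _).
  by rewrite (ord1 (i : 'I_1)) (ord1 (last : 'I_1)).
have [s_lt0|s_ge0] := real_ltP sR (real0 _).
  (* Negative case: the model form is the first coordinate, the one with positive sign in the
     hyperbolic ball. *)
  pose p : 'I_N.+1 := ord0.
  have [|M nM] := @normalizes_ex _ _ l _ _ (plane_swap_mxM p).
    rewrite col_last_plane_mx.
    apply: (@isometry_onto_line _ _ _ JJ adjJ _ _ (-1)); first by right.
      rewrite sform_plane !mxE eqxx eq_lrshift eq_rlshift.
      by rewrite rmorph0 rmorph1; ring.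
    by rewrite mulN1r oppr_gt0.
  exists (plane_mx p 0 1 1 0), M; split=> //.
  exists (hyperbolic_ball R N.+1); last by constructor 2.
  move=> z; rewrite lorentz_plane mulr0 add0r mulr1 addr0 normr1 expr1n.
  rewrite /hyperbolic_ball/= (big_pred1 p)//.
  by rewrite -[X in _ <-> is_true X]subr_gt0 subr0 addrAC subr_gt0.
have s0 : s = 0 by apply/eqP; rewrite eq_le s_le0.
(* Null case: if the last entry vanished, so would the sum of the other squared moduli, and [l] with
   it. *)
have ll0 : l last 0 != 0.
  apply: contra_neq l0 => l00; apply/colP => i; rewrite mxE.
  case: (split_ordP i) => j ->; last by rewrite (ord1 j).
  move/eqP: s0; rewrite sE l00 normr0 expr0n/= sub0r oppr_eq0 psumr_eq0; last first.
    by move=> k _; rewrite exprn_ge0.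
  by move=> /allP/(_ j)/(_ (mem_index_enum j)); rewrite sqrf_eq0 normr_eq0 => /eqP.
pose p : 'I_N.+1 := ord_max.
(* The model null form has entries [t] at [p] and 1 at the end. Orthogonality to [l] for both signs
   would give [2 l_last = 0] by addition. *)
have [t [tt tR tl]] : exists t : Cx R,
    [/\ t * t = 1, t^* = t & l last 0 - t * l (lshift 1 p) 0 != 0].
  have [e|e] := eqVneq (l last 0 - 1 * l (lshift 1 p) 0) 0; last first.
    by exists 1; split; rewrite ?rmorph1 ?mulr1.
  exists (-1); split; rewrite ?rmorphN1 ?mulrNN ?mulr1//.
  have -> : l last 0 - -1 * l (lshift 1 p) 0 =
     2%:R * l last 0 - (l last 0 - 1 * l (lshift 1 p) 0) by ring.
  by rewrite e subr0 mulf_neq0// pnatr_eq0.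
have [|M nM] := @normalizes_ex _ _ l _ _ (plane_cayley_mxM p tt).
  rewrite col_last_plane_mx; apply: isometry_onto_null_line => //.
    rewrite sform_plane !mxE eqxx eq_lrshift eq_rlshift eqxx rmorph1 tR.
    by rewrite !mulr0 addr0 add0r !mulr1 tt subrr.
  by rewrite sform_plane rmorph1 mul1r tR.
exists (plane_mx p (- t / 2) (1 / 2) (t / 2) (1 / 2)), M; split=> //.
exists (half_space R N.+1); last by constructor 3.
move=> z; rewrite lorentz_plane /half_space/=.
rewrite [X in _ < X](big_pred1 p); last first.
  by move=> i; rewrite /= eqSS -val_eqE.
rewrite [X in X < _](eq_bigl (fun j => j != p)); last first.
  by move=> i; rewrite /= eqSS -val_eqE.
(* As [t ^ 2 = 1], this is [|1 + x|^2 / 4 - |1 - x|^2 / 4 = Re x]. *)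
suff -> : `|z 0 p * (1 / 2) + 1 / 2| ^+ 2 - `|z 0 p * (- t / 2) + t / 2| ^+ 2 =
          'Re (z 0 p) by rewrite subr_gt0.
have hR : (2^-1)^* = 2^-1 :> Cx R by rewrite fmorphV rmorph_nat.
rewrite !normCK !mul1r !rmorphD !rmorphM !rmorphN/= hR tR ReE.
set x := z 0 p; set y := x^*.
transitivity ((x / 2 + 2^-1) * (y / 2 + 2^-1)
  - t * t * ((2^-1 - x / 2) * (2^-1 - y / 2))); first by field.
by rewrite tt; field.
Qed.

(** * Rational maps of maximal embedding dimension *)

Section RationalMaps.
Context {R : realType} {n N : nat}.
Variables (f : 'rV[Cx R]_n -> 'rV[Cx R]_N).
Variables (p : 'I_N -> mpoly n (Cx R)) (g : mpoly n (Cx R)).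
Notation U := (unit_ball R n).
Hypotheses (holf : holomorphic_on U f) (fpg : rational_form U f p g).

(** By continuity, since the zeros of [g] have empty interior. It extends identities from the set
    where [f = p / g] to the whole ball. *)
Lemma differentiable_eq0_off_zeros (h : 'rV[Cx R]_n -> Cx R) z :
  U z -> differentiable h z ->
  (forall x, U x -> meval (x 0) g != 0 -> h x = 0) -> h z = 0.
Proof.
move=> Uz dh h0; apply/eqP/negPn/negP => hz.
have nh : \forall x \near z, h x != 0.
  exact: cvgr_neq0 (differentiable_continuous dh) hz.
have [g0 _] := fpg.
have [x [Ux hx] gx] := nbhs_mpoly_nonroot g0 (filterI (nbhs_unit_ball Uz) nh).
by move: hx; rewrite h0 ?eqxx.
Qed.

Lemma numeratorE z j : U z -> meval (z 0) (p j) = meval (z 0) g * f z 0 j.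
Proof.
move=> Uz; apply/eqP; rewrite -subr_eq0; apply/eqP.
pose h (x : 'rV[Cx R]_n) : Cx R := meval (x 0) (p j) - meval (x 0) g * f x 0 j.
apply: (@differentiable_eq0_off_zeros h) => // [|x Ux gx]; last first.
  rewrite /h; have [_ ->//] := fpg.
  by rewrite !mxE mulVKf// subrr.
apply: (@differentiableB _ _ _ (fun x : 'rV[Cx R]_n => meval (x 0) (p j) : Cx R)).
  exact: differentiable_meval.
apply: (@differentiableM _ _ (fun x : 'rV[Cx R]_n => meval (x 0) g : Cx R)).
  exact: differentiable_meval.
apply: (@differentiable_comp _ _ _ _ f (fun y => y 0 j : Cx R)); first exact: holf.
exact: differentiable_coord.
Qed.

(** Homogeneous coordinates [[p_1 : ... : p_N : g]] of [f]. *)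
Definition homogeneous_lift (i : 'I_(N + 1)) : mpoly n (Cx R) :=
  match fintype.split i with inl j => p j | inr _ => g end.

Lemma homogeneous_liftE z i : U z ->
  meval (z 0) (homogeneous_lift i) = meval (z 0) g * row_mx (f z) 1%:M 0 i.
Proof.
move=> Uz; rewrite /homogeneous_lift mxE; case: fintype.split => j.
  exact: numeratorE.
by rewrite (ord1 j) mxE eqxx mulr1.
Qed.

Lemma msize_homogeneous_lift i :
  (msize (homogeneous_lift i) <= (max_degree p g).+1)%N.
Proof.
rewrite /homogeneous_lift /max_degree; case: fintype.split => j.
  rewrite (leq_trans (leqSpred _))// ltnS leq_max.
  by rewrite (@leq_bigmax 'I_N (fun j => (msize (p j)).-1)).
by rewrite (leq_trans (leqSpred _))// ltnS leq_max leqnn orbT.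
Qed.

Lemma meval_lift_comb (c : 'cV[Cx R]_(N + 1)) z : U z ->
  meval (z 0) (\sum_i c i 0 *: homogeneous_lift i) =
  meval (z 0) g * (row_mx (f z) 1%:M *m c) 0 0.
Proof.
move=> Uz; rewrite raddf_sum mxE mulr_sumr; apply: eq_bigr => i _.
by rewrite [LHS]mevalZ homogeneous_liftE// mulrCA [c i 0 * _]mulrC.
Qed.

(** Every relation between the lifted components kills [(f, 1)], first off the zeros of [g] and then
    everywhere. So [(f, 1)] lies in the row space of [P], and a rank deficit would put the image in
    too small an affine subspace. *)
Lemma row_free_lift : embedding_dimension U f
    ('C(n + max_degree p g, max_degree p g) - 1)%N ->
  row_free (coef_mx (max_degree p g) homogeneous_lift).
Proof.
set d := max_degree p g; set P := coef_mx d _ => -[_ minf].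
rewrite /row_free eqn_leq rank_leq_row/= leqNgt; apply/negP => rP.
have U0 : U 0.
  rewrite /unit_ball/= big1 ?ltr01// => i _.
  by rewrite mxE normr0 expr0n.
have [W dW fW] : exists2 W : {vspace 'rV[Cx R]_N}, (\dim W < \rank P)%N &
    forall s, (f @` U) s -> s - f 0 \in W.
  apply: affine_section_dim => [|_ [z Uz <-]]; first by exists 0.
  apply: sub_coef_mx => [i|c c0]; first exact: msize_homogeneous_lift.
  apply/matrixP => i j; rewrite !ord1 [RHS]mxE.
  apply: (@differentiable_eq0_off_zeros (fun x => (row_mx (f x) 1%:M *m c) 0 0)) => //.
    apply: (@differentiable_comp _ _ _ _ f (fun y => (row_mx y 1%:M *m c) 0 0 : Cx R)).
      exact: holf.
    exact: differentiable_affine_form.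
  move=> x Ux gx; apply: (mulfI gx).
  by rewrite -meval_lift_comb// c0 meval0 mulr0.
have /minf : image_in_affine_subspace U f (\dim W).
  exists (f 0), W; split => // s /fW sW /=.
  by exists (s - f 0) => //; rewrite addrC subrK.
rewrite leqNgt => /negP; apply.
(* Both [dim W < rank P] and the rank deficit are strict, which places [dim W] below the binomial
   minus 1. *)
have := leq_trans dW (ltnW (leq_trans rP (card_bmultinom n d))).
move: (leq_trans rP (card_bmultinom n d)); lia.
Qed.

End RationalMaps.

Theorem proposition6p1 (R : realType) (n N d : nat)
    (f : 'rV[Cx R]_n -> 'rV[Cx R]_N) :
  rational_proper_map (unit_ball R n) (unit_ball R N) f ->
  rational_degree (unit_ball R n) f d ->
  embedding_dimension (unit_ball R n) f ('C(n + d, d) - 1)%N ->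
  exists M : 'M[Cx R]_(N + 1),
    [/\ M \in unitmx,
        f @` unit_ball R n `<=` lf_domain M
      & [\/ polynomial_proper_map (unit_ball R n) (unit_ball R N)
              (lf_map M \o f),
            polynomial_proper_map (unit_ball R n) (hyperbolic_ball R N)
              (lf_map M \o f)
          | polynomial_proper_map (unit_ball R n) (half_space R N)
              (lf_map M \o f)]].
Proof.
move=> [properf _] [p [g [fpg _ <-]]] embf; have [holf _ _] := properf.
have [l l1] := row_free_coef_mx (msize_homogeneous_lift p g)
  (row_free_lift holf fpg embf).
(* Along the image [l] takes the value [1 / g], so it never vanishes there. *)
have gl z : unit_ball R n z ->
    meval (z 0) g * (row_mx (f z) 1%:M *m l) 0 0 = 1.
  by move=> Uz; rewrite -(meval_lift_comb holf fpg)// l1 meval1.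
have l0 : l != 0.
  apply/eqP => l0; move: l1; rewrite l0 big1 => [/esym/eqP|i _].
    by rewrite oner_eq0.
  by rewrite mxE scale0r.
have [E [M [[uM [c c0 cM] ME] [T TE TT]]]] := exists_normal_form l0.
have denomE z : lf_denominator M (f z) = c * (row_mx (f z) 1%:M *m l) 0 0.
  rewrite lf_denominatorE /lf_homogeneous.
  transitivity ((row_mx (f z) 1%:M *m col (rshift N 0) M) 0 0).
    by rewrite mul_colE.
  by rewrite cM -scalemxAr mxE.
have l_neq0 z : unit_ball R n z -> (row_mx (f z) 1%:M *m l) 0 0 != 0.
  by move=> /gl; apply: contra_eq_neq => ->; rewrite mulr0 eq_sym oner_eq0.
have fM : f @` unit_ball R n `<=` lf_domain M.
  move=> _ [z Uz <-]; rewrite /lf_domain/= denomE mulf_neq0 ?l_neq0//.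
exists M; split; [exact: uM|exact: fM|].
have polyT : polynomial_proper_map (unit_ball R n) T (lf_map M \o f).
  split.
    apply: proper_holomorphic_lf_map uM fM _ properf => z.
    by rewrite ME; exact: TE.
  (* The denominator is [c / g]; dividing by it multiplies [(f, 1)] by [g], which gives the
     polynomial lift up to [c^-1]. *)
  exists (fun j => c^-1 *: \sum_i M i (lshift 1 j) *: homogeneous_lift p g i).
  move=> z Uz; apply/rowP => j; rewrite [RHS]mxE mevalZ.
  transitivity (c^-1 * (meval (z 0) g *
      (row_mx (f z) 1%:M *m col (lshift 1 j) M) 0 0)).
    have -> : meval (z 0) g = ((row_mx (f z) 1%:M *m l) 0 0)^-1.
      by apply: (mulIf (l_neq0 _ Uz)); rewrite mulVf ?l_neq0// gl.
    by rewrite /= /lf_map denomE mul_colE mxE [lsubmx _ _ _]mxE invfM mulrA.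
  rewrite -(meval_lift_comb holf fpg)//; congr (_ * meval _ _).
  by apply: eq_bigr => i _; rewrite mxE.
by case: TT => TE'; rewrite -TE'; [constructor 1|constructor 2|constructor 3].
Qed.
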